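(* Let $k\geq 2$, let $I\subseteq\mathbb{Z}^+$ be a finite set, and let $n\geq \max(I\cup\{0\})+k-1$. Then \[\Delta^k\big((d_k(r_{n+k}(I),1,n+k),\,d_k(r_{n+k}(I),2,n+k),\ldots,d_k(r_{n+k}(I),n+k,n+k))\big)\] \[=(d_k(r_n(I),1,n),\,d_k(r_n(I),2,n),\ldots,d_k(r_n(I),n,n)).\]
   Context: For $w\in S_n$ (the permutations of $[n]=\{1,\dots,n\}$) and $k\ge 2$, $D_k(w)$ is the set of indices $i$ with $1\le i\le n-k+1$ and $w(i)>w(i+1)>\cdots>w(i+k-1)$. For a finite set $J\subseteq\mathbb{Z}^+$ and $1\le m\le n$, $d_k(J,m,n)$ is the number of $w\in S_n$ with $D_k(w)=J$ and $w(1)=m$. For finite $I=\{i_1,\ldots,i_\ell\}\subseteq\mathbb{Z}^+$ and $N\ge\max(I\cup\{0\})+k-1$, the $N$-reverse of $I$ (for the given $k$) is $r_N(I)=\{N+2-k-i_1,\ldots,N+2-k-i_\ell\}$ (with $r_N(\emptyset)=\emptyset$). The difference operator $\Delta$ on finite sequences of reals is $\Delta((a_1,\ldots,a_N))=(a_2-a_1,a_3-a_2,\ldots,a_N-a_{N-1})$ for $N\ge 2$, and $\Delta$ of a sequence of length $0$ or $1$ is the empty sequence. $\Delta^k$ is the $k$-th iterate of $\Delta$. *)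

(* Defs.v *)
From mathcomp Require Import all_boot all_order all_algebra.
From mathcomp Require Import perm finmap reals.

Set Implicit Arguments.
Unset Strict Implicit.
Unset Printing Implicit Defensive.

Import GRing.Theory.

Local Open Scope fset_scope.
Local Open Scope nat_scope.

(* Since ['I_n] is {0, ..., n-1}, the one-line notation of [w] shifts the
   values of [w] back to {1, ..., n}; [wval w i] is w(i) for 1 <= i <= n, and
   is only meaningful in that range. *)
Definition oneline (n : nat) (w : 'S_n) : seq nat := [seq (w j).+1 | j : 'I_n].

Definition wval (n : nat) (w : 'S_n) (i : nat) : nat := nth 0 (oneline w) i.-1.

(* [n.+1 - k] is n - k + 1 without truncation trouble at n = k - 1, and
   i + j, i + j + 1 for j < k - 1 run over the consecutive pairs of
   positions in i, ..., i + k - 1. *)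
Definition kdescents (k n : nat) (w : 'S_n) : {fset nat} :=
  [fset i in iota 1 (n.+1 - k)
     | [forall j : 'I_k.-1, wval w (i + j) > wval w (i + j).+1]].

Definition dcount (k : nat) (J : {fset nat}) (m n : nat) : nat :=
  #|[set w : 'S_n | (kdescents k w == J) && (wval w 1 == m)]|.

(* The subtraction is exact when every i in I satisfies i + k - 1 <= N. *)
Definition Nreverse (k N : nat) (I : {fset nat}) : {fset nat} :=
  [fset N + 2 - k - i | i in I].

Definition delta (V : zmodType) (s : seq V) : seq V :=
  if s is a :: s' then pairmap (fun x y => (y - x)%R) a s' else [::].

(* Main.v *)
Require Import Defs.
From mathcomp Require Import all_boot all_order all_algebra.
From mathcomp Require Import perm finmap reals.
From mathcomp Require Import zify.

(** Record for a permutation w of [n] its descent word t in {0,1}^(n-1), with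
    t_i = 1 iff w(i) > w(i+1).  Deleting the first letter of w and
    standardizing the rest is a bijection between the w in S_(n+1) with
    w(1) = m and the v in S_n, and the descent word of w is that of v preceded
    by the bit [v(1) < m].  For a function phi on words, let S_n(phi) be the
    sequence indexed by m of the sums of phi over the descent words of the w
    in S_n with w(1) = m.  When m grows by one, the leading bit changes only
    for the v with v(1) = m, so that
      Delta S_(n+1)(phi) = S_n(diff phi),
      diff phi t = phi (1 t) - phi (0 t)
    ([delta_dsum]); hence Delta^k S_(n+k)(phi) = S_n(diff^k phi).

    The condition D_k(w) = J depends only on t: i is in D_k(w) iff k - 1
    consecutive ones start at position i of t.  Put r = k - 1 and let [runs r t]
    be the word marking these positions.  The reverses satisfy
    r_(n+k)(I) = r_n(I) + k, so if M is the indicator word of r_n(I), then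
    0^k M is that of r_(n+k)(I), and it remains to see that
      diff^k [runs r t = 0^k M] = [runs r t = M].
    The left side is a signed sum over the k bits u put in front of t, those u
    being excluded that create a run of r ones starting among them.  The first
    bit of u affects the mark at position 1 only, and both of its values are
    admissible, hence cancel, unless the next r - 1 bits are ones; in that case
    it must be 0, and the last bit of u must be 0 as well, or else there would
    be a run at position 2.  Thus only u = 0 1^(r-1) 0 survives.  It has sign
    +1, and it is admissible whatever t is: its first 0 blocks the run at
    position 1, its last 0 those at positions 2, ..., k.  [iter_diff_runs] performs this computation one bit at a time. *)

Set Implicit Arguments.
Unset Strict Implicit.
Unset Printing Implicit Defensive.

Import GRing.Theory.

Local Open Scope nat_scope.

(** * Descent words and deletion of the first letter *)

Definition descents (s : seq nat) : seq bool :=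
  if s is a :: s' then pairmap (fun x y => y < x) a s' else [::].

Lemma size_descents s : size (descents s) = (size s).-1.
Proof. by case: s => //= a s; rewrite size_pairmap. Qed.

Lemma nth_descents s i : i.+1 < size s ->
  nth false (descents s) i = (nth 0 s i.+1 < nth 0 s i).
Proof. by case: s => //= a s lt_i; rewrite (nth_pairmap 0). Qed.

Lemma descents_map (f : nat -> nat) s :
  (forall x y, (f x < f y) = (x < y)) -> descents (map f s) = descents s.
Proof.
by move=> f_mono; case: s => //= a s; elim: s a => //= b s IHs a; rewrite f_mono IHs.
Qed.

Lemma ltn_bump h x y : (bump h x < bump h y) = (x < y).
Proof. by rewrite !ltnNge leq_bump2. Qed.

Lemma size_oneline n (w : 'S_n) : size (oneline w) = n.
Proof. by rewrite /oneline size_map size_enum_ord. Qed.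

Lemma oneline_cons n (w : 'S_n.+1) :
  oneline w = (w ord0).+1 :: [seq (w (lift ord0 j)).+1 | j : 'I_n].
Proof. by rewrite /oneline /image_mem enum_ordSl /= -map_comp. Qed.

Lemma wval1 n (w : 'S_n.+1) : wval w 1 = (w ord0).+1.
Proof. by rewrite /wval oneline_cons. Qed.

Lemma oneline_lift_perm n (m : 'I_n.+1) (v : 'S_n) :
  oneline (lift_perm ord0 m v) = m.+1 :: map (bump m.+1) (oneline v).
Proof.
rewrite oneline_cons lift_perm_id /oneline -map_comp; congr (_ :: _).
by apply: eq_map => j /=; rewrite lift_perm_lift bumpS.
Qed.

Lemma descents_lift_perm n (m : 'I_n.+2) (v : 'S_n.+1) :
  descents (oneline (lift_perm ord0 m v)) =
    (wval v 1 < m.+1) :: descents (oneline v).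
Proof.
rewrite oneline_lift_perm wval1 -(descents_map (oneline v) (ltn_bump m.+1)).
rewrite [oneline v]oneline_cons /=; congr (_ :: _).
by rewrite /bump; case: leqP; lia.
Qed.

(** Deleting the i-th letter j of w and standardizing is inverse to
    [lift_perm i j]. *)
Lemma reindex_lift_perm (V : nmodType) n (i j : 'I_n.+1) (G : 'S_n.+1 -> V) :
  (\sum_(w : 'S_n.+1 | w i == j) G w = \sum_(v : 'S_n) G (lift_perm i j v))%R.
Proof.
rewrite (reindex (lift_perm i j)) /=; last first.
  pose del (w : 'S_n.+1) (k : 'I_n) : 'I_n := odflt k (unlift (w i) (w (lift i k))).
  have lift_del (w : 'S_n.+1) k : lift (w i) (del w k) = w (lift i k).
    rewrite /del; case: unliftP => //= /perm_inj /eqP.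
    by rewrite eq_sym (negPf (neq_lift i k)).
  have del_inj (w : 'S_n.+1) : injective (del w).
    by move=> k1 k2 eq_k; apply/(@lift_inj _ i)/(@perm_inj _ w); rewrite -!lift_del eq_k.
  exists (fun w : 'S_n.+1 => perm (@del_inj w)) => [v _ | w /eqP wi].
    apply/permP=> k; rewrite permE; apply: (@lift_inj _ j).
    by rewrite -{1}(lift_perm_id i j v) lift_del lift_perm_lift.
  apply/permP=> k; case: (unliftP i k) => [l|] ->; last by rewrite lift_perm_id.
  by rewrite lift_perm_lift permE -wi lift_del.
by apply: eq_bigl => v; rewrite lift_perm_id eqxx.
Qed.

(** * Differences of sums over permutations with a given first letter *)

Definition dsum (V : nmodType) n (phi : seq bool -> V) m : V :=
  (\sum_(w : 'S_n | wval w 1 == m) phi (descents (oneline w)))%R.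

Definition diff (V : zmodType) (phi : seq bool -> V) (t : seq bool) : V :=
  (phi (true :: t) - phi (false :: t))%R.

Lemma dsum_delete (V : nmodType) n (phi : seq bool -> V) m :
  0 < m <= n.+2 ->
  dsum n.+2 phi m =
    (\sum_(v : 'S_n.+1) phi ((wval v 1 < m)%N :: descents (oneline v)))%R.
Proof.
case: m => //= m lt_m.
transitivity (\sum_(w : 'S_n.+2 | w ord0 == Ordinal lt_m)
                phi (descents (oneline w)))%R.
  by apply: eq_bigl => w; rewrite wval1 eqSS.
by rewrite reindex_lift_perm; apply: eq_bigr => v _; rewrite descents_lift_perm.
Qed.

(** As m grows to m + 1, the leading bit [v(1) < m] of the summand of v
    switches from 0 to 1 if v(1) = m and is constant otherwise. *)
Lemma dsum_diff (V : zmodType) n (phi : seq bool -> V) m :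
  0 < m <= n.+1 ->
  (dsum n.+2 phi m.+1 - dsum n.+2 phi m = dsum n.+1 (diff phi) m)%R.
Proof.
move=> m_bd; rewrite !dsum_delete; [|lia..].
rewrite -sumrB /dsum [RHS]big_mkcond /=; apply: eq_bigr => v _.
rewrite ltnS leq_eqVlt /diff.
by case: eqP => [->|_]; rewrite ?ltnn ?orbT //= subrr.
Qed.

Lemma delta_map_iota (V : zmodType) (f : nat -> V) a n :
  delta [seq f m | m <- iota a n.+1] = [seq (f m.+1 - f m)%R | m <- iota a n].
Proof. by rewrite /delta /=; elim: n a => //= n IHn a; rewrite IHn. Qed.

Lemma delta_dsum (V : zmodType) n (phi : seq bool -> V) :
  delta [seq dsum n.+2 phi m | m <- iota 1 n.+2] =
    [seq dsum n.+1 (diff phi) m | m <- iota 1 n.+1].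
Proof.
rewrite delta_map_iota; apply/eq_in_map => m.
by rewrite mem_iota add1n ltnS; apply: dsum_diff.
Qed.

Lemma iter_delta_dsum (V : zmodType) k n (phi : seq bool -> V) :
  iter k (@delta V) [seq dsum (n + k).+1 phi m | m <- iota 1 (n + k).+1] =
    [seq dsum n.+1 (iter k (@diff V) phi) m | m <- iota 1 n.+1].
Proof.
elim: k phi => [|k IHk] phi; first by rewrite addn0.
by rewrite !iterSr addnS delta_dsum IHk.
Qed.

Lemma eq_iter_diff (V : zmodType) k (phi psi : seq bool -> V) :
  phi =1 psi -> iter k (@diff V) phi =1 iter k (@diff V) psi.
Proof.
by move=> eq_phi; elim: k => //= k IHk t; rewrite /diff !IHk.
Qed.

(** * Runs of ones *)

(** Past the end of a word [nth] returns [false], so an all-ones window of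
    positive length is automatically contained in the word. *)
Definition ones_at (r : nat) (t : seq bool) (i : nat) : bool :=
  all (nth false t) (iota i r).

Definition runs (r : nat) (t : seq bool) : seq bool :=
  [seq ones_at r t i | i <- iota 0 (size t)].

(** The default [false] of [nth] makes a run that ends with the word maximal. *)
Definition first_run (j : nat) (t : seq bool) : bool :=
  ones_at j t 0 && ~~ nth false t j.

Lemma ones_at_cons r b t i : ones_at r (b :: t) i.+1 = ones_at r t i.
Proof. by rewrite /ones_at -add1n iotaDl all_map. Qed.

Lemma ones_at0_cons r b t : ones_at r.+1 (b :: t) 0 = b && ones_at r t 0.
Proof. by rewrite {1}/ones_at /=; congr (_ && _); apply: ones_at_cons. Qed.

Lemma ones_at0S r t : ones_at r.+1 t 0 = ones_at r t 0 && nth false t r.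
Proof. by rewrite /ones_at -addn1 iotaD all_cat /= andbT. Qed.

Lemma runs_cons r b t : runs r.+1 (b :: t) = (b && ones_at r t 0) :: runs r.+1 t.
Proof.
rewrite /runs /= ones_at0_cons; congr (_ :: _).
by rewrite -[1]addn0 iotaDl -map_comp; apply: eq_map => i; apply: ones_at_cons.
Qed.

Lemma first_run_cons j b t : first_run j.+1 (b :: t) = b && first_run j t.
Proof. by rewrite /first_run ones_at0_cons andbA. Qed.

Lemma ones_atW i j t : i <= j -> ones_at j t 0 -> ones_at i t 0.
Proof. by move=> le_ij; rewrite /ones_at -(subnKC le_ij) iotaD all_cat => /andP[]. Qed.

Lemma first_run_ones j r t : first_run j t -> j < r -> ~~ ones_at r t 0.
Proof.
case/andP=> _ not_j lt_jr; apply: contra not_j => /(ones_atW lt_jr).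
by rewrite ones_at0S => /andP[].
Qed.

Section DiffRuns.

Variables (V : pzRingType) (r : nat) (M : seq bool).

(** The windows have length r + 1, where r = k - 2, so that they are nonempty. *)
Definition runs_ind (j : nat) (t : seq bool) : V :=
  (runs r.+1 t == nseq j false ++ M)%:R%R.

Definition first_run_ind (j : nat) (t : seq bool) : V :=
  (- (first_run j t && (runs r.+1 t == nseq j.+1 false ++ M))%:R)%R.

(** The two terms cancel unless 1 t has mark 1 at position 1, that is, unless t
    starts with r ones.  The word r.+1 zeros followed by M puts mark 0 at
    position 1 of t, so there are then exactly r of them. *)
Lemma diff_runs_ind : diff (runs_ind r.+2) =1 first_run_ind r.
Proof.
move=> t; rewrite /diff /runs_ind /first_run_ind /first_run !runs_cons /= !eqseq_cons /=.
have [ones|] := boolP (ones_at r t 0); last by rewrite /= subrr oppr0.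
rewrite /= sub0r; case: eqP => // [runs_t|]; last by rewrite andbF.
suff -> : ~~ nth false t r by [].
case: t ones runs_t => [|b t] ones; first by rewrite nth_nil.
by rewrite runs_cons -ones_at0_cons ones_at0S ones => -[->].
Qed.

(** A leading 0 leaves an empty initial run, so only the term of 1 t survives;
    its mark at position 1 is 0 since its initial run has length j + 1 <= r. *)
Lemma diff_first_run_ind j : j < r -> diff (first_run_ind j.+1) =1 first_run_ind j.
Proof.
move=> lt_jr t; rewrite /diff /first_run_ind !first_run_cons !runs_cons /=.
rewrite oppr0 subr0 eqseq_cons; case run_t: (first_run j t) => //=.
by rewrite (negPf (first_run_ones run_t lt_jr)).
Qed.

(** Here only the term of 0 t survives, with a minus sign that cancels the one
    in [first_run_ind]. *)
Lemma diff_first_run_ind0 : diff (first_run_ind 0) =1 runs_ind 0.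
Proof.
move=> t; rewrite /diff /first_run_ind /first_run /runs_ind !runs_cons /=.
by rewrite eqseq_cons /= oppr0 opprK add0r.
Qed.

(** The successive differences of the indicator of [runs r.+1 t = 0^(r+2) M]
    are, up to sign, indicators of the words t with [runs r.+1 t = 0^(j+1) M]
    and initial run of length exactly j, for j = r, r - 1, ..., 0: each bit
    prepended to t must be 1 to lengthen the initial run, and the last one must
    be 0 to leave it empty. *)
Lemma iter_diff_runs : iter r.+2 (@diff V) (runs_ind r.+2) =1 runs_ind 0.
Proof.
have diffs j : j <= r -> iter j (@diff V) (first_run_ind j) =1 first_run_ind 0.
  elim: j => // j IHj lt_jr t.
  by rewrite iterSr (eq_iter_diff j (diff_first_run_ind lt_jr)) IHj // ltnW.
move=> t; rewrite iterSr (eq_iter_diff _ diff_runs_ind) iterS.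
by rewrite /diff !diffs // -diff_first_run_ind0.
Qed.

End DiffRuns.

(** * Descent sets as words *)

(** Indicator word of J on [1, p], to be compared with the words [runs r t]. *)
Definition mask (p : nat) (J : {fset nat}) : seq bool := [seq i \in J | i <- iota 1 p].

Lemma eq_mask p (J K : {fset nat}) :
  (forall i, i \in J -> 0 < i <= p) -> (forall i, i \in K -> 0 < i <= p) ->
  (mask p J == mask p K) = (J == K).
Proof.
move=> bdJ bdK; apply/eqP/eqP => [/eq_in_map eqJK | -> //].
apply/fsetP => i; have [i_bd|i_out] := boolP (0 < i <= p).
  by apply: eqJK; rewrite mem_iota add1n ltnS.
by rewrite (contraNF (bdJ i) i_out) (contraNF (bdK i) i_out).
Qed.

Lemma kdescents_bound k n (w : 'S_n) i :
  1 < k -> i \in kdescents k w -> 0 < i <= n.-1.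
Proof. by move=> k_gt1; rewrite !inE mem_iota => /andP[]; lia. Qed.

Lemma runs_descents k n (w : 'S_n) : 1 < k ->
  runs k.-1 (descents (oneline w)) = mask n.-1 (kdescents k w).
Proof.
move=> k_gt1; rewrite /runs size_descents size_oneline /mask.
rewrite -[1]addn0 iotaDl -map_comp; apply/eq_in_map => i.
rewrite mem_iota /= add0n => lt_i.
have nthD j : i + j < n.-1 ->
    nth false (descents (oneline w)) (i + j) =
      (wval w (1 + i + j).+1 < wval w (1 + i + j)).
  by move=> lt_ij; rewrite nth_descents ?size_oneline //; lia.
rewrite !inE mem_iota /ones_at; apply/allP/andP => [ones|[i_bd /forallP ones] j].
  have in_word j : j < k.-1 -> i + j < n.-1.
    move=> lt_j; have /ones : i + j \in iota i k.-1 by rewrite mem_iota; lia.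
    apply: contraTT; rewrite -leqNgt => le_n.
    by rewrite nth_default // size_descents size_oneline.
  (* The last position of the window lies in the word. *)
  split; first by have := in_word k.-2; lia.
  apply/forallP => j; rewrite -nthD ?in_word //.
  by apply: ones; rewrite mem_iota; have := ltn_ord j; lia.
rewrite mem_iota => j_bd; have lt_j : j - i < k.-1 by lia.
have := ones (Ordinal lt_j); rewrite -nthD /=; last by lia.
by rewrite subnKC //; lia.
Qed.

Lemma dcount_dsum (V : pzRingType) k n (J : {fset nat}) m :
  1 < k -> (forall i, i \in J -> 0 < i <= n.-1) ->
  ((dcount k J m n)%:R)%R =
    dsum n (fun t => (runs k.-1 t == mask n.-1 J)%:R%R : V) m.
Proof.
move=> k_gt1 bdJ; rewrite /dcount /dsum -sum1dep_card natr_sum.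
rewrite big_mkcondl /=; apply: eq_bigr => w _.
rewrite runs_descents // eq_mask //; first by case: eqP.
by move=> i; apply: kdescents_bound.
Qed.

Section Reverse.

Variables (k n : nat) (I : {fset nat}).
Hypothesis k_gt1 : 1 < k.
Hypothesis bdI : forall i, i \in I -> 0 < i /\ i + k <= n.+1.

Lemma Nreverse_bound i : i \in Nreverse k n I -> 0 < i <= n.-1.
Proof. by case/imfsetP => j /= /bdI[]; lia. Qed.

Lemma Nreverse_shift i :
  (i \in Nreverse k (n + k) I) = (k < i) && (i - k \in Nreverse k n I).
Proof.
apply/imfsetP/andP => [[j /= Ij ->]|[lt_ki /imfsetP[j /= Ij eq_i]]].
  have [j_gt0 le_j] := bdI Ij; split; first by lia.
  by apply/imfsetP; exists j => //=; lia.
by exists j => //=; have [] := bdI Ij; lia.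
Qed.

Lemma mask_Nreverse_shift p :
  mask (k + p) (Nreverse k (n + k) I) = nseq k false ++ mask p (Nreverse k n I).
Proof.
rewrite /mask iotaD map_cat; congr (_ ++ _).
  rewrite -[in RHS](size_iota 1 k).
  rewrite -(size_map (fun i => i \in Nreverse k (n + k) I) (iota 1 k)).
  apply/all_pred1P/allP => _ /mapP[i i_bd ->]; rewrite mem_iota in i_bd.
  by rewrite /= Nreverse_shift; have -> : (k < i) = false by lia.
rewrite (addnC 1 k) iotaDl -map_comp; apply/eq_in_map => i.
rewrite mem_iota /= Nreverse_shift addKn => /andP[i_gt0 _].
by rewrite -addn1 leq_add2l i_gt0.
Qed.

End Reverse.

Theorem theorem2p7 (R : realType) (k n : nat) (I : {fset nat})
    (hk : 2 <= k) (hI : forall i : nat, i \in I -> 0 < i)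
    (hn : (\max_(i <- I) i) + k - 1 <= n) :
  iter k (@delta R)
    [seq (dcount k (Nreverse k (n + k) I) m (n + k))%:R%R | m <- iota 1 (n + k)]
  = [seq (dcount k (Nreverse k n I) m n)%:R%R | m <- iota 1 n].
Proof.
have bdI i : i \in I -> 0 < i /\ i + k <= n.+1.
  move=> Ii; split; first exact: hI.
  have : i <= \max_(j <- I) j by apply: (@leq_bigmax_seq _ _ xpredT id).
  by lia.
have bdI' i : i \in I -> 0 < i /\ i + k <= (n + k).+1 by move=> /bdI; lia.
case: n k hk hn bdI bdI' => [|p] [|[|r]] // hk hn bdI bdI'; first by lia.
under eq_map => m do rewrite (dcount_dsum R _ hk (Nreverse_bound hk bdI')).
under [RHS]eq_map => m do rewrite (dcount_dsum R _ hk (Nreverse_bound hk bdI)).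
rewrite addSn iter_delta_dsum; apply: eq_map => m; apply: eq_bigr => w _.
have := mask_Nreverse_shift hk bdI p; rewrite addnC !addSn /= => ->.
exact: iter_diff_runs.
Qed.
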